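(* Let $r>0$ and $h_0\ne h_1$, and consider the 2-periodic difference equation $y_{n+1}=y_n e^{r-y_{n-1}}+h_{n \bmod 2}$, $n\ge 0$, with initial conditions $(y_0,y_{-1})\in\mathbb{R}_+^2$. Write $f(t)=e^{r-t}$. If both $h_0>r$ and $h_1>r$, and the system $$\begin{cases} x-h_1=(xf(y)+h_0)\,f(yf(x)+h_1)\\ y-h_0=(yf(x)+h_1)\,f(xf(y)+h_0)\end{cases}$$ has a unique solution $(x,y)\in\mathbb{R}_+^2$, then the 2-cycle $\{\bar z_0,\bar z_1\}$ of the equation is globally asymptotically stable.
   Context: $\mathbb{R}_+=[0,\infty)$. A 2-cycle $\{\bar z_0,\bar z_1\}$ of the equation is a pair of non-negative numbers with $\bar z_0=\bar z_1 f(\bar z_0)+h_1$ and $\bar z_1=\bar z_0 f(\bar z_1)+h_0$; such a 2-cycle always exists, and $(\bar z_0,\bar z_1)$ is a solution of the displayed system. It gives the 2-periodic solution with $y_{2n}=\bar z_0$, $y_{2n+1}=\bar z_1$. With $T_j(x,y)=(xf(y)+h_j,x)$, the 2-cycle is locally asymptotically stable if $(\bar z_0,\bar z_1)$ is a locally asymptotically stable fixed point of $T_1\circ T_0$; it is globally asymptotically stable if, in addition, every solution with initial conditions in $\mathbb{R}_+^2$ satisfies $y_{2n}\to\bar z_0$ and $y_{2n+1}\to\bar z_1$. *)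

(* Defs.v *)
From Stdlib Require Import Reals ZArith.
From Coquelicot Require Import Coquelicot.
Open Scope R_scope.

Definition f (r t : R) : R := exp (r - t).

Definition quadrant (p : R * R) : Prop := 0 <= fst p /\ 0 <= snd p.

(* Solutions are indexed by [Z] so that [y (-1)] is literally the second
   initial value; values of [y] below -1 are unconstrained and never used. *)
Definition is_solution (r h0 h1 : R) (y : Z -> R) : Prop :=
  forall n : Z, (0 <= n)%Z ->
    y (n + 1)%Z = y n * f r (y (n - 1)%Z) + (if Z.even n then h0 else h1).

Definition T (r h : R) (p : R * R) : R * R :=
  (fst p * f r (snd p) + h, fst p).

Definition is_two_cycle (r h0 h1 : R) (z : R * R) : Prop :=
  quadrant z /\
  fst z = snd z * f r (fst z) + h1 /\
  snd z = fst z * f r (snd z) + h0.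

(* Local asymptotic stability of a fixed point of [F], seen as a self-map of
   [D]: Lyapunov stability together with local attractivity, both relative
   to [D]. *)
Definition stable_in {U : UniformSpace} (D : U -> Prop) (F : U -> U) (z : U)
  : Prop :=
  forall eps : posreal, exists delta : posreal,
    forall w : U, D w -> ball z delta w ->
      forall n : nat, ball z eps (Nat.iter n F w).

Definition locally_attracting_in {U : UniformSpace} (D : U -> Prop)
  (F : U -> U) (z : U) : Prop :=
  exists delta : posreal,
    forall w : U, D w -> ball z delta w ->
      filterlim (fun n : nat => Nat.iter n F w) eventually (locally z).

Definition LAS_fixed_point {U : UniformSpace} (D : U -> Prop)
  (F : U -> U) (z : U) : Prop :=
  D z /\ F z = z /\ stable_in D F z /\ locally_attracting_in D F z.

Definition two_cycle_LAS (r h0 h1 : R) (z : R * R) : Prop :=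
  LAS_fixed_point quadrant (fun p => T r h1 (T r h0 p)) z.

Definition two_cycle_GAS (r h0 h1 : R) (z : R * R) : Prop :=
  two_cycle_LAS r h0 h1 z /\
  forall y : Z -> R,
    is_solution r h0 h1 y -> quadrant (y 0%Z, y (-1)%Z) ->
    is_lim_seq (fun n : nat => y (2 * Z.of_nat n)%Z) (fst z) /\
    is_lim_seq (fun n : nat => y (2 * Z.of_nat n + 1)%Z) (snd z).

Definition solves_system (r h0 h1 x y : R) : Prop :=
  x - h1 = (x * f r y + h0) * f r (y * f r x + h1) /\
  y - h0 = (y * f r x + h1) * f r (x * f r y + h0).

(* Main.v *)
(** Evaluating the increasing argument of the two-step map [T_1 o T_0] at one
    corner of a box and the decreasing arguments at the opposite corner gives a
    decoupled map [corner p q], increasing in [p], decreasing in [q], with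
    [corner p p = T_1 (T_0 p)].  Since [h0, h1 > r], every orbit enters a box
    [[lo, hi]] with [lo <= corner lo hi] and [corner hi lo <= hi].  Iterating
    [(lo, hi) |-> (corner lo hi, corner hi lo)] yields nested invariant boxes,
    whose corners converge to a pair with [lo = corner lo hi] and
    [hi = corner hi lo].  For such a pair both [(fst hi, snd lo)] and
    [(fst lo, snd hi)] solve the system, so uniqueness collapses the boxes to
    the 2-cycle, which attracts every orbit.  The 2-cycle stays in the interior
    of each box because [corner] is strictly monotone; hence it is also
    Lyapunov stable, without linearization. *)
From Stdlib Require Import Reals ZArith Lra Lia.
From Coquelicot Require Import Coquelicot.
Require Import Defs.
Open Scope R_scope.

(** * Boxes and the corner map *)

Definition le2 (p q : R * R) : Prop := fst p <= fst q /\ snd p <= snd q.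
Definition lt2 (p q : R * R) : Prop := fst p < fst q /\ snd p < snd q.

Definition corner (r h0 h1 : R) (p q : R * R) : R * R :=
  ((fst p * f r (snd q) + h0) * f r (fst q) + h1, fst p * f r (snd q) + h0).

Definition two_step (r h0 h1 : R) (p : R * R) : R * R := T r h1 (T r h0 p).

Definition box_step (r h0 h1 : R) (b : (R * R) * (R * R)) :
    (R * R) * (R * R) :=
  (corner r h0 h1 (fst b) (snd b), corner r h0 h1 (snd b) (fst b)).

Definition box_iter (r h0 h1 : R) (b : (R * R) * (R * R)) (n : nat) :
    (R * R) * (R * R) :=
  Nat.iter n (box_step r h0 h1) b.

Definition trapping (r h0 h1 : R) (b : (R * R) * (R * R)) : Prop :=
  quadrant (fst b) /\ le2 (fst b) (snd b) /\
  le2 (fst b) (corner r h0 h1 (fst b) (snd b)) /\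
  le2 (corner r h0 h1 (snd b) (fst b)) (snd b).

Definition in_box (b : (R * R) * (R * R)) (p : R * R) : Prop :=
  le2 (fst b) p /\ le2 p (snd b).

(** Strict inequalities make the box a neighbourhood of [p], which Lyapunov stability needs. *)
Definition inside_box (b : (R * R) * (R * R)) (p : R * R) : Prop :=
  lt2 (fst b) p /\ lt2 p (snd b).

Lemma le2_trans (p q s : R * R) : le2 p q -> le2 q s -> le2 p s.
Proof. unfold le2; intros; lra. Qed.

(** * Monotonicity of the corner map *)

Lemma f_pos (r t : R) : 0 < f r t.
Proof. apply exp_pos. Qed.

Lemma f_lt (r s t : R) : s < t -> f r t < f r s.
Proof. intros; apply exp_increasing; lra. Qed.

Lemma f_le (r s t : R) : s <= t -> f r t <= f r s.
Proof. intros [H | ->]; [left; now apply f_lt | right; reflexivity]. Qed.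

Lemma f_lt_1 (r t : R) : r < t -> f r t < 1.
Proof. intros; rewrite <- exp_0; apply exp_increasing; lra. Qed.

Lemma f_continuous (r t : R) : continuous (f r) t.
Proof.
  apply continuity_pt_filterlim, derivable_continuous_pt.
  unfold f; reg.
Qed.

Lemma is_lim_seq_f (r l : R) (u : nat -> R) :
  is_lim_seq u l -> is_lim_seq (fun n => f r (u n)) (f r l).
Proof.
  apply is_lim_seq_continuous, continuity_pt_filterlim, f_continuous.
Qed.

Lemma mul_f_add_le (r h x x' t t' : R) :
  0 <= x -> x <= x' -> t' <= t -> x * f r t + h <= x' * f r t' + h.
Proof.
  intros; apply Rplus_le_compat_r, Rmult_le_compat; auto.
  - left; apply f_pos.
  - now apply f_le.
Qed.

Lemma mul_f_add_lt (r h x x' t t' : R) :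
  0 <= x -> x < x' -> t' < t -> x * f r t + h < x' * f r t' + h.
Proof.
  intros; apply Rplus_lt_compat_r, Rmult_le_0_lt_compat; auto.
  - left; apply f_pos.
  - now apply f_lt.
Qed.

Lemma mul_f_add_ge (r h x t : R) : 0 <= x -> h <= x * f r t + h.
Proof. intros; generalize (Rmult_le_pos _ _ H (Rlt_le _ _ (f_pos r t))); lra. Qed.

Lemma corner_diag (r h0 h1 : R) (p : R * R) : corner r h0 h1 p p = two_step r h0 h1 p.
Proof. reflexivity. Qed.

Lemma corner_ge (r h0 h1 : R) (p q : R * R) :
  0 <= h0 -> 0 <= fst p -> le2 (h1, h0) (corner r h0 h1 p q).
Proof.
  intros Hh Hp.
  generalize (mul_f_add_ge r h0 _ (snd q) Hp); intros H.
  split; simpl; [apply mul_f_add_ge; lra | exact H].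
Qed.

Lemma corner_le (r h0 h1 : R) (p p' q q' : R * R) :
  0 <= h0 -> 0 <= fst p -> le2 p p' -> le2 q' q ->
  le2 (corner r h0 h1 p q) (corner r h0 h1 p' q').
Proof.
  intros Hh Hp [H1 H2] [H3 H4].
  generalize (mul_f_add_ge r h0 _ (snd q) Hp); intros H.
  generalize (mul_f_add_le r h0 _ _ _ _ Hp H1 H4); intros H'.
  split; simpl; [apply mul_f_add_le; lra | exact H'].
Qed.

Lemma corner_lt (r h0 h1 : R) (p p' q q' : R * R) :
  0 <= h0 -> 0 <= fst p -> lt2 p p' -> lt2 q' q ->
  lt2 (corner r h0 h1 p q) (corner r h0 h1 p' q').
Proof.
  intros Hh Hp [H1 H2] [H3 H4].
  generalize (mul_f_add_ge r h0 _ (snd q) Hp); intros H.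
  generalize (mul_f_add_lt r h0 _ _ _ _ Hp H1 H4); intros H'.
  split; simpl; [apply mul_f_add_lt; lra | exact H'].
Qed.

Lemma two_cycle_fixed (r h0 h1 : R) (z : R * R) :
  is_two_cycle r h0 h1 z -> two_step r h0 h1 z = z.
Proof.
  destruct z as [x y]; intros (_ & H1 & H0); simpl in *.
  unfold two_step, T; simpl; rewrite <- H0, <- H1; reflexivity.
Qed.

(** * Invariance of trapping boxes *)

Lemma box_iter_succ (r h0 h1 : R) b n :
  box_iter r h0 h1 b (S n) = box_step r h0 h1 (box_iter r h0 h1 b n).
Proof. reflexivity. Qed.

(** The new corners are a larger lower corner and a smaller upper one, so applying the monotone
    [corner] to them moves the values inward once more. *)
Lemma trapping_step (r h0 h1 : R) b :
  0 <= h0 -> trapping r h0 h1 b -> trapping r h0 h1 (box_step r h0 h1 b).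
Proof.
  intros Hh (Hq & Hlh & Hlo & Hhi); destruct b as [lo hi]; simpl in *.
  assert (0 <= fst lo) by apply Hq.
  assert (0 <= fst hi) by (destruct Hlh; lra).
  assert (0 <= fst (corner r h0 h1 lo hi)) by (destruct Hlo; lra).
  assert (Hq' : quadrant (corner r h0 h1 lo hi)).
  { destruct Hlo, Hq; split; lra. }
  assert (Hlh' : le2 (corner r h0 h1 lo hi) (corner r h0 h1 hi lo)) by now apply corner_le.
  split; [exact Hq' |]; split; [exact Hlh' |].
  split; apply corner_le; auto; destruct Hlh'; cbn [box_step fst snd]; lra.
Qed.

Lemma trapping_iter (r h0 h1 : R) b n :
  0 <= h0 -> trapping r h0 h1 b -> trapping r h0 h1 (box_iter r h0 h1 b n).
Proof.
  intros Hh Hb; induction n; [exact Hb |].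
  rewrite box_iter_succ; now apply trapping_step.
Qed.

(** The two-step map is [corner] on the diagonal, so its value at [w] is squeezed between the values
    at the two opposite pairs of corners. *)
Lemma in_box_step (r h0 h1 : R) b w :
  0 <= h0 -> trapping r h0 h1 b -> in_box b w ->
  in_box (box_step r h0 h1 b) (two_step r h0 h1 w).
Proof.
  intros Hh (Hq & _) [H1 H2]; rewrite <- corner_diag.
  split; apply corner_le; auto; destruct Hq, H1; lra.
Qed.

Lemma inside_box_step (r h0 h1 : R) b z :
  0 <= h0 -> trapping r h0 h1 b -> two_step r h0 h1 z = z -> inside_box b z ->
  inside_box (box_step r h0 h1 b) z.
Proof.
  intros Hh (Hq & _) Hz [H1 H2]; rewrite <- Hz, <- corner_diag.
  split; apply corner_lt; auto; destruct Hq, H1; lra.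
Qed.

Lemma inside_box_iter (r h0 h1 : R) b z n :
  0 <= h0 -> trapping r h0 h1 b -> two_step r h0 h1 z = z -> inside_box b z ->
  inside_box (box_iter r h0 h1 b n) z.
Proof.
  intros Hh Hb Hz H; induction n; [exact H |].
  rewrite box_iter_succ; apply inside_box_step; auto; now apply trapping_iter.
Qed.

Lemma orbit_in_box_iter (r h0 h1 : R) b w n :
  0 <= h0 -> trapping r h0 h1 b -> in_box b w ->
  in_box (box_iter r h0 h1 b n) (Nat.iter n (two_step r h0 h1) w).
Proof.
  intros Hh Hb H; induction n; [exact H |].
  rewrite box_iter_succ; simpl; apply in_box_step; auto; now apply trapping_iter.
Qed.

(** Here the box stays fixed: its image under [box_step] lies within it, so it is forward
    invariant. *)
Lemma orbit_in_box (r h0 h1 : R) b w n :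
  0 <= h0 -> trapping r h0 h1 b -> in_box b w ->
  in_box b (Nat.iter n (two_step r h0 h1) w).
Proof.
  intros Hh Hb H; induction n; [exact H |]; simpl.
  destruct (in_box_step _ _ _ _ _ Hh Hb IHn) as [H1 H2].
  destruct Hb as (_ & _ & H3 & H4).
  split; [exact (le2_trans _ _ _ H3 H1) | exact (le2_trans _ _ _ H2 H4)].
Qed.

(** * The algebraic system and 2-cycles *)

Lemma solution_gives_two_cycle (r h0 h1 : R) (z : R * R) :
  0 <= h0 -> 0 <= h1 ->
  (forall p, quadrant p /\ solves_system r h0 h1 (fst p) (snd p) -> z = p) ->
  quadrant z -> solves_system r h0 h1 (fst z) (snd z) ->
  is_two_cycle r h0 h1 z.
Proof.
  intros Hh0 Hh1 Huniq Hq [H1 H0]; destruct z as [x y]; simpl in *.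
  destruct Hq as [Hx Hy]; simpl in *.
  (* The system is invariant under this involution of its solutions. *)
  assert (E : (x, y) = (y * f r x + h1, x * f r y + h0)).
  { apply Huniq; unfold quadrant, solves_system; simpl.
    generalize (mul_f_add_ge r h0 _ y Hx) (mul_f_add_ge r h1 _ x Hy); intros.
    replace ((y * f r x + h1) * f r (x * f r y + h0) + h0) with y by lra.
    replace ((x * f r y + h0) * f r (y * f r x + h1) + h1) with x by lra.
    repeat split; lra. }
  (* Being fixed by the involution is exactly the pair of 2-cycle equations. *)
  injection E; intros; repeat split; simpl; auto.
Qed.

Lemma two_cycle_solves_system (r h0 h1 : R) (z : R * R) :
  is_two_cycle r h0 h1 z -> solves_system r h0 h1 (fst z) (snd z).
Proof.
  intros (_ & H1 & H0); unfold solves_system.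
  rewrite <- H0, <- H1; lra.
Qed.

Lemma fixed_corners (r h0 h1 : R) (lo hi z : R * R) :
  (forall p, quadrant p /\ solves_system r h0 h1 (fst p) (snd p) -> z = p) ->
  quadrant lo -> quadrant hi ->
  corner r h0 h1 lo hi = lo -> corner r h0 h1 hi lo = hi -> lo = z /\ hi = z.
Proof.
  destruct lo as [m0 m1], hi as [M0 M1].
  intros Huniq [Hm0 Hm1] [HM0 HM1] Hlo Hhi; unfold corner in *; simpl in *.
  injection Hlo; intros E1 E0; injection Hhi; intros E3 E2.
  (* The equations now read [m1 = m0 f(M1) + h0], [m0 = m1 f(M0) + h1], [M1 = M0 f(m1) + h0] and
     [M0 = M1 f(m0) + h1]. At [(M0, m1)] the inner expressions of the system are therefore [M1] and
     [m0]; at [(m0, M1)] they are [m1] and [M0]. *)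
  rewrite E1 in E0; rewrite E3 in E2.
  assert (A : z = (M0, m1)).
  { apply Huniq; unfold quadrant, solves_system; simpl; rewrite E0, E3; lra. }
  assert (B : z = (m0, M1)).
  { apply Huniq; unfold quadrant, solves_system; simpl; rewrite E2, E1; lra. }
  rewrite A in B; injection B; intros EB1 EB0.
  rewrite A, EB0, EB1; split; reflexivity.
Qed.

(** * Convergence of the nested boxes *)

Definition lim2 (u : nat -> R * R) (l : R * R) : Prop :=
  is_lim_seq (fun n => fst (u n)) (fst l) /\
  is_lim_seq (fun n => snd (u n)) (snd l).

Lemma lim2_corner (r h0 h1 : R) (u v : nat -> R * R) (p q : R * R) :
  lim2 u p -> lim2 v q ->
  lim2 (fun n => corner r h0 h1 (u n) (v n)) (corner r h0 h1 p q).
Proof.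
  intros [U0 U1] [V0 V1].
  assert (H : is_lim_seq (fun n => fst (u n) * f r (snd (v n)) + h0)
                (fst p * f r (snd q) + h0)).
  { apply is_lim_seq_plus'; [| apply is_lim_seq_const].
    apply is_lim_seq_mult'; [exact U0 | now apply is_lim_seq_f]. }
  split; simpl; [| exact H].
  apply is_lim_seq_plus'; [| apply is_lim_seq_const].
  apply is_lim_seq_mult'; [exact H | now apply is_lim_seq_f].
Qed.

Lemma lim2_succ_unique (u v : nat -> R * R) (p q : R * R) :
  (forall n, u (S n) = v n) -> lim2 u p -> lim2 v q -> q = p.
Proof.
  intros E [U0 U1] [V0 V1].
  apply is_lim_seq_incr_1 in U0; apply is_lim_seq_incr_1 in U1.
  apply (is_lim_seq_ext _ _ _ (fun n => f_equal fst (E n))) in U0.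
  apply (is_lim_seq_ext _ _ _ (fun n => f_equal snd (E n))) in U1.
  apply is_lim_seq_unique in U0; apply is_lim_seq_unique in U1.
  apply is_lim_seq_unique in V0; apply is_lim_seq_unique in V1.
  rewrite U0 in V0; rewrite U1 in V1.
  destruct p, q; simpl in *; congruence.
Qed.

(** The bound [le2 a l] serves to keep the limits of the corners in the quadrant. *)
Lemma lim2_monotone (u : nat -> R * R) (a b : R * R) :
  (forall n, le2 (u n) (u (S n))) \/
  (forall n, le2 (u (S n)) (u n)) ->
  (forall n, le2 a (u n)) -> (forall n, le2 (u n) b) ->
  exists l, lim2 u l /\ le2 a l.
Proof.
  intros Hmon Ha Hb.
  assert (H : ex_finite_lim_seq (fun n => fst (u n)) /\
              ex_finite_lim_seq (fun n => snd (u n))).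
  { destruct Hmon as [Hi | Hd]; split.
    - apply ex_finite_lim_seq_incr with (fst b); [apply Hi | apply Hb].
    - apply ex_finite_lim_seq_incr with (snd b); [apply Hi | apply Hb].
    - apply ex_finite_lim_seq_decr with (fst a); [apply Hd | apply Ha].
    - apply ex_finite_lim_seq_decr with (snd a); [apply Hd | apply Ha]. }
  destruct H as [[x Hx] [y Hy]]; exists (x, y); split; [split; assumption |].
  split.
  - apply (is_lim_seq_le (fun _ => fst a) (fun n => fst (u n)) (fst a) x);
      [apply Ha | apply is_lim_seq_const | exact Hx].
  - apply (is_lim_seq_le (fun _ => snd a) (fun n => snd (u n)) (snd a) y);
      [apply Ha | apply is_lim_seq_const | exact Hy].
Qed.

Lemma box_iter_lim (r h0 h1 : R) b (z : R * R) :
  0 <= h0 -> trapping r h0 h1 b ->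
  (forall p, quadrant p /\ solves_system r h0 h1 (fst p) (snd p) -> z = p) ->
  lim2 (fun n => fst (box_iter r h0 h1 b n)) z /\
  lim2 (fun n => snd (box_iter r h0 h1 b n)) z.
Proof.
  intros Hh Hb Huniq.
  assert (Htr : forall n, trapping r h0 h1 (box_iter r h0 h1 b n))
    by (intros n; now apply trapping_iter).
  assert (Hin : forall n, le2 (fst b) (fst (box_iter r h0 h1 b n)) /\
                          le2 (snd (box_iter r h0 h1 b n)) (snd b)).
  { induction n; [unfold le2; simpl; lra |].
    destruct (Htr n) as (_ & _ & H1 & H2), IHn as [H3 H4].
    rewrite box_iter_succ; split;
      [exact (le2_trans _ _ _ H3 H1) | exact (le2_trans _ _ _ H2 H4)]. }
  assert (Hmid : forall n, le2 (fst (box_iter r h0 h1 b n))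
                               (snd (box_iter r h0 h1 b n))) by apply Htr.
  destruct (lim2_monotone (fun n => fst (box_iter r h0 h1 b n))
              (fst b) (snd b)) as [lo [Llo Blo]].
  { left; intros n; apply (Htr n). }
  { intros n; apply Hin. }
  { intros n; apply le2_trans with (1 := Hmid n), Hin. }
  destruct (lim2_monotone (fun n => snd (box_iter r h0 h1 b n))
              (fst b) (snd b)) as [hi [Lhi Bhi]].
  { right; intros n; apply (Htr n). }
  { intros n; apply le2_trans with (2 := Hmid n), Hin. }
  { intros n; apply Hin. }
  destruct Hb as [[Q0 Q1] _].
  destruct (fixed_corners r h0 h1 lo hi z) as [-> ->]; auto.
  - destruct Blo; split; lra.
  - destruct Bhi; split; lra.
  (* By continuity, the recursion for the corners passes to the limit. *)
  - refine (lim2_succ_unique _ _ _ _ _ Llo (lim2_corner r h0 h1 _ _ _ _ Llo Lhi)).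
    reflexivity.
  - refine (lim2_succ_unique _ _ _ _ _ Lhi (lim2_corner r h0 h1 _ _ _ _ Lhi Llo)).
    reflexivity.
Qed.

(** * Absorbing boxes and global attraction *)

Lemma trapping_box_exists (r h0 h1 a : R) :
  0 <= r -> r < h0 -> r < h1 ->
  exists B, a < B /\ trapping r h0 h1 ((h1, h0), (B, B)).
Proof.
  intros Hr H0 H1.
  (* This is where [h0, h1 > r] enters: opposite the lower corner [(h1, h0)], both growth factors
     are below 1, and an affine map of slope below 1 sends [B] below itself once [B] passes its
     fixed point [h / (1 - t)]. *)
  assert (F0 := f_lt_1 r h0 H0); assert (F1 := f_lt_1 r h1 H1).
  assert (K : forall h t, 0 <= h -> t < 1 ->
                forall B, h / (1 - t) <= B -> B * t + h <= B).
  { intros h t Hh Ht B HB.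
    apply Rmult_le_compat_r with (r := 1 - t) in HB; [| lra].
    unfold Rdiv in HB; rewrite Rmult_assoc, Rinv_l in HB; lra. }
  pose (B := Rmax (a + 1) (Rmax (Rmax h0 h1)
               (Rmax (h0 / (1 - f r h0)) (h1 / (1 - f r h1))))).
  assert (HB : a + 1 <= B /\ h0 <= B /\ h1 <= B /\
               h0 / (1 - f r h0) <= B /\ h1 / (1 - f r h1) <= B).
  { unfold B, Rmax; repeat destruct Rle_dec; lra. }
  clearbody B; destruct HB as (Ba & B0 & B1 & C0 & C1).
  apply K in C0; [| lra | lra]; apply K in C1; [| lra | lra].
  exists B; split; [lra |]; unfold trapping; simpl.
  split; [split; simpl; lra |].
  split; [split; simpl; lra |].
  split; [apply corner_ge; simpl; lra |].
  split; simpl; [| exact C0].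
  (* The inner value is at most [B] by [C0], so [C1] bounds the outer one. *)
  apply Rle_trans with (2 := C1), mul_f_add_le; [| exact C0 | lra].
  generalize (mul_f_add_ge r h0 B h0); lra.
Qed.

Lemma orbit_attracted (r h0 h1 : R) (z w : R * R) :
  0 <= r -> r < h0 -> r < h1 ->
  (forall p, quadrant p /\ solves_system r h0 h1 (fst p) (snd p) -> z = p) ->
  quadrant w ->
  lim2 (fun n => Nat.iter n (two_step r h0 h1) w) z.
Proof.
  intros Hr H0 H1 Huniq [Hw _].
  (* The point [w] may lie below [(h1, h0)], but its image cannot, so the box is chosen around [w1]
     and the index is shifted by one at the end. *)
  set (w1 := two_step r h0 h1 w).
  destruct (trapping_box_exists r h0 h1 (Rmax (fst w1) (snd w1)) Hr H0 H1)
    as [B [HB Hb]].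
  generalize (Rmax_l (fst w1) (snd w1)) (Rmax_r (fst w1) (snd w1)); intros.
  assert (Hin : in_box ((h1, h0), (B, B)) w1).
  { split; [unfold w1; rewrite <- corner_diag; apply corner_ge; lra |].
    split; cbn [fst snd]; lra. }
  assert (Hh : 0 <= h0) by lra.
  destruct (box_iter_lim r h0 h1 _ z Hh Hb Huniq) as [[L0 L1] [U0 U1]].
  assert (Hn := fun n => orbit_in_box_iter r h0 h1 _ w1 n Hh Hb Hin).
  assert (E : forall n, Nat.iter (S n) (two_step r h0 h1) w =
                        Nat.iter n (two_step r h0 h1) w1)
    by (intros n; apply Nat.iter_succ_r).
  split; apply is_lim_seq_incr_1.
  - apply is_lim_seq_ext with (fun n => fst (Nat.iter n (two_step r h0 h1) w1)).
    { intros n; now rewrite E. }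
    refine (is_lim_seq_le_le _ _ _ _ _ L0 U0).
    intros n; split; apply (Hn n).
  - apply is_lim_seq_ext with (fun n => snd (Nat.iter n (two_step r h0 h1) w1)).
    { intros n; now rewrite E. }
    refine (is_lim_seq_le_le _ _ _ _ _ L1 U1).
    intros n; split; apply (Hn n).
Qed.

(** * Lyapunov stability *)

Lemma lim2_filterlim (u : nat -> R * R) (l : R * R) :
  lim2 u l -> filterlim u eventually (locally l).
Proof.
  intros [H0 H1]; apply filterlim_locally; intros eps.
  apply is_lim_seq_spec in H0; apply is_lim_seq_spec in H1.
  destruct (H0 eps) as [N0 K0], (H1 eps) as [N1 K1].
  exists (max N0 N1); intros n Hn.
  split; [apply K0 | apply K1]; lia.
Qed.

Lemma in_box_of_ball b (z : R * R) :
  inside_box b z ->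
  exists delta : posreal, forall w, ball z delta w -> in_box b w.
Proof.
  intros [[A0 A1] [B0 B1]].
  (* Least distance from [z] to the four sides of the box. *)
  pose (d := Rmin (Rmin (fst z - fst (fst b)) (snd z - snd (fst b)))
                  (Rmin (fst (snd b) - fst z) (snd (snd b) - snd z))).
  assert (Hd : 0 < d) by (unfold d; repeat apply Rmin_pos; lra).
  assert (D : d <= fst z - fst (fst b) /\ d <= snd z - snd (fst b) /\
              d <= fst (snd b) - fst z /\ d <= snd (snd b) - snd z).
  { unfold d, Rmin; repeat destruct Rle_dec; lra. }
  exists (mkposreal d Hd); intros w [W0 W1].
  apply Rabs_def2 in W0; apply Rabs_def2 in W1.
  unfold minus, plus, opp in *; simpl in *.
  repeat split; lra.
Qed.

(** Some iterated box has both corners within [eps] of [z]. It is forward invariant and still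
    contains [z] in its interior, so any ball around [z] inside it supplies [delta]. *)
Lemma two_cycle_stable (r h0 h1 : R) (z : R * R) :
  0 <= r -> r < h0 -> r < h1 ->
  (forall p, quadrant p /\ solves_system r h0 h1 (fst p) (snd p) -> z = p) ->
  is_two_cycle r h0 h1 z ->
  stable_in quadrant (two_step r h0 h1) z.
Proof.
  intros Hr H0 H1 Huniq Hz eps.
  assert (Hh : 0 <= h0) by lra.
  destruct (trapping_box_exists r h0 h1 (Rmax (fst z) (snd z)) Hr H0 H1)
    as [B [HB Hb]].
  generalize (Rmax_l (fst z) (snd z)) (Rmax_r (fst z) (snd z)); intros.
  (* Both coordinates of [z] are positive and [f] is positive, so the 2-cycle equations put [z]
     strictly above [(h1, h0)]. *)
  assert (Hin : inside_box ((h1, h0), (B, B)) z).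
  { destruct Hz as ([Q0 Q1] & E1 & E0).
    generalize (mul_f_add_ge r h1 _ (fst z) Q1)
               (mul_f_add_ge r h0 _ (snd z) Q0); intros.
    assert (0 < snd z * f r (fst z))
      by (apply Rmult_lt_0_compat; [lra | apply f_pos]).
    assert (0 < fst z * f r (snd z))
      by (apply Rmult_lt_0_compat; [lra | apply f_pos]).
    repeat split; simpl; lra. }
  destruct (box_iter_lim r h0 h1 _ z Hh Hb Huniq) as [L U].
  apply lim2_filterlim in L; apply lim2_filterlim in U.
  destruct (proj1 (filterlim_locally _ _) L eps) as [N1 K1].
  destruct (proj1 (filterlim_locally _ _) U eps) as [N2 K2].
  set (N := max N1 N2).
  assert (KL := K1 N ltac:(lia)); assert (KU := K2 N ltac:(lia)).
  set (b := box_iter r h0 h1 ((h1, h0), (B, B)) N) in *.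
  assert (Hb' : trapping r h0 h1 b) by now apply trapping_iter.
  destruct (in_box_of_ball b z) as [delta Hdelta].
  { apply inside_box_iter; auto; now apply two_cycle_fixed. }
  exists delta; intros w _ Hw n.
  destruct (orbit_in_box r h0 h1 b w n Hh Hb' (Hdelta w Hw))
    as [[A0 A1] [B0 B1]].
  destruct KL as [L0 L1], KU as [U0 U1].
  apply Rabs_def2 in L0; apply Rabs_def2 in L1.
  apply Rabs_def2 in U0; apply Rabs_def2 in U1.
  unfold minus, plus, opp in *; simpl in *.
  split; apply Rabs_def1; unfold minus, plus, opp; simpl; lra.
Qed.

Lemma two_cycle_LAS_of_unique (r h0 h1 : R) (z : R * R) :
  0 <= r -> r < h0 -> r < h1 ->
  (forall p, quadrant p /\ solves_system r h0 h1 (fst p) (snd p) -> z = p) ->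
  is_two_cycle r h0 h1 z -> two_cycle_LAS r h0 h1 z.
Proof.
  intros Hr H0 H1 Huniq Hz.
  split; [apply Hz |].
  split; [exact (two_cycle_fixed _ _ _ _ Hz) |].
  split; [exact (two_cycle_stable _ _ _ _ Hr H0 H1 Huniq Hz) |].
  (* Attraction holds on the whole quadrant, so the radius is arbitrary. *)
  exists (mkposreal 1 Rlt_0_1); intros w Hw _.
  exact (lim2_filterlim _ _ (orbit_attracted _ _ _ _ _ Hr H0 H1 Huniq Hw)).
Qed.

(** * From orbits to solutions of the equation *)

Lemma solution_two_step (r h0 h1 : R) (y : Z -> R) (n : nat) :
  is_solution r h0 h1 y ->
  (y (2 * Z.of_nat n)%Z, y (2 * Z.of_nat n - 1)%Z) =
  Nat.iter n (two_step r h0 h1) (y 0%Z, y (-1)%Z).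
Proof.
  intros Hy; induction n; [reflexivity |].
  rewrite Nat.iter_succ, <- IHn; unfold two_step, T; cbn [fst snd].
  set (k := (2 * Z.of_nat n)%Z).
  assert (A := Hy k ltac:(lia)); assert (B := Hy (k + 1)%Z ltac:(lia)).
  rewrite Z.even_add in B.
  (* The step from the even index [k] adds [h0] and the next adds [h1], matching [T_0] followed by
     [T_1]. *)
  assert (E : Z.even k = true) by (unfold k; now rewrite Z.even_mul).
  rewrite E in A, B; simpl in B.
  replace (k + 1 - 1)%Z with k in B by lia.
  replace (2 * Z.of_nat (S n))%Z with (k + 1 + 1)%Z by lia.
  replace (k + 1 + 1 - 1)%Z with (k + 1)%Z by lia.
  now rewrite B, A.
Qed.

Theorem theorem4p7 (r h0 h1 : R)
  (r_pos : 0 < r) (h0_neq_h1 : h0 <> h1) (h0_gt_r : h0 > r) (h1_gt_r : h1 > r)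
  (system_unique :
     exists! p : R * R, quadrant p /\ solves_system r h0 h1 (fst p) (snd p)) :
  (exists z : R * R, is_two_cycle r h0 h1 z) /\
  (forall z : R * R, is_two_cycle r h0 h1 z -> two_cycle_GAS r h0 h1 z).
Proof.
  destruct system_unique as [p [[Hq Hs] Huniq]].
  split; [exists p; apply solution_gives_two_cycle; auto; lra |].
  intros z Hz.
  (* Every 2-cycle solves the system, hence is its unique solution. *)
  assert (E : p = z).
  { apply Huniq; split; [apply Hz | exact (two_cycle_solves_system _ _ _ _ Hz)]. }
  subst p; split; [apply two_cycle_LAS_of_unique; auto; lra |].
  intros y Hy Hinit.
  destruct (orbit_attracted r h0 h1 z (y 0%Z, y (-1)%Z)) as [L0 L1];
    auto; try lra.
  split.
  - refine (is_lim_seq_ext _ _ _ _ L0).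
    intros n; now rewrite <- solution_two_step.
  (* The second coordinate of the [n]-th iterate is the term of index [2n - 1]; shifting [n] by one
     gives index [2n + 1]. *)
  - apply is_lim_seq_incr_1 in L1; refine (is_lim_seq_ext _ _ _ _ L1).
    intros n; rewrite <- solution_two_step by assumption; cbn [snd].
    f_equal; lia.
Qed.
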